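(* Let $H=(h_{ij})$ be an $n\times n$ real upper Hessenberg matrix with diagonal elements $\alpha_i=h_{ii}$ and subdiagonal elements $\beta_i=h_{i,i-1}$, let $3\le k\le n$, and assume the floating point assumptions stated in the context. If, for $3\le i\le k$, $$\hat c_i^{(i)}=-\mathrm{fl}\left[\mathrm{fl}\left[\alpha_i\hat c_{i-1}^{(i-1)}\right]+\mathrm{fl}\left[\sum_{m=1}^{i-2}{h_{i-m,i}\,\beta_i\cdots \beta_{i-m+1}\,\hat c_{i-m-1}^{(i-m-1)}}+h_{1i}\,\beta_i\cdots\beta_2\right]\right],$$ and, for $3\le j\le k$, $j+1\le i\le n$, $$\hat c_j^{(i)}=\mathrm{fl}\left[\mathrm{fl}\left[\hat c_j^{(i-1)}-\mathrm{fl}\left[\alpha_i\hat c_{j-1}^{(i-1)}\right]\right]-\mathrm{fl}\left[\sum_{m=1}^{j-2}{h_{i-m,i}\,\beta_i\cdots \beta_{i-m+1}\,\hat c_{j-m-1}^{(i-m-1)}}+h_{i-j+1,i}\,\beta_i\cdots \beta_{i-j+2}\right]\right],$$ then, for $3\le i\le k$, $$|e_i^{(i)}|\leq |\alpha_ie_{i-1}^{(i-1)}|+\sum_{m=1}^{i-2}{|h_{i-m,i}\,\beta_i\cdots \beta_{i-m+1}\,e_{i-m-1}^{(i-m-1)}|}+ \gamma_{i+1}\sum_{m=2}^{i-2}{|h_{i-m,i}\,\beta_i\cdots \beta_{i-m+1}\,\hat c_{i-m-1}^{(i-m-1)}|}$$ $$\qquad + \gamma_{i}\left(|h_{i-1,i}\,\beta_i\,\hat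 c_{i-2}^{(i-2)}|+|h_{1i}\,\beta_i\cdots \beta_2|\right)+u \left(|\hat c_i^{(i)}|+|\alpha_i\hat c_{i-1}^{(i-1)}|\right),$$ and, for $3\le j\le k$, $j+1\le i\le n$, $$|e_j^{(i)}|\leq |e_j^{(i-1)}|+|\alpha_ie_{j-1}^{(i-1)}|+\sum_{m=1}^{j-2}{|h_{i-m,i}\,\beta_i\cdots \beta_{i-m+1}\, e_{j-m-1}^{(i-m-1)}|}+\gamma_{j+1}\sum_{m=2}^{j-2}{|h_{i-m,i}\,\beta_i\cdots \beta_{i-m+1}\,\hat{c}_{j-m-1}^{(i-m-1)}|}$$ $$\qquad+\gamma_{j}\left(|h_{i-1,i}\,\beta_i \,\hat c_{j-2}^{(i-2)}|+|h_{i-j+1,i}\,\beta_i\cdots \beta_{i-j+2}|\right)+u \left(|\hat c_j^{(i)}|+|\hat c_j^{(i-1)}|\right)+\gamma_{2} \,|\alpha_i\hat c_{j-1}^{(i-1)}|.$$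
   Context: $H_i$ is the leading principal submatrix of $H$ of order $i$, and $\det(\lambda I-H_i)=\lambda^i+c_1^{(i)}\lambda^{i-1}+\cdots+c_{i-1}^{(i)}\lambda+c_i^{(i)}$, $1\le i\le n$. Equivalently: $c_1^{(1)}=-\alpha_1$; $c_1^{(i)}=c_1^{(i-1)}-\alpha_i$ for $i\ge2$; $c_2^{(2)}=\alpha_1\alpha_2-h_{12}\beta_2$; for $2\le j\le i-1$, $c_j^{(i)}=c_j^{(i-1)}-\alpha_ic_{j-1}^{(i-1)}-\sum_{m=1}^{j-2}h_{i-m,i}\beta_i\cdots\beta_{i-m+1}c_{j-m-1}^{(i-m-1)}-h_{i-j+1,i}\beta_i\cdots\beta_{i-j+2}$; for $i\ge3$, $c_i^{(i)}=-\alpha_ic_{i-1}^{(i-1)}-\sum_{m=1}^{i-2}h_{i-m,i}\beta_i\cdots\beta_{i-m+1}c_{i-m-1}^{(i-m-1)}-h_{1i}\beta_i\cdots\beta_2$. Here $\beta_i\cdots\beta_{i-m+1}$ is the product of the $m$ numbers $\beta_i,\beta_{i-1},\ldots,\beta_{i-m+1}$. Empty sums are zero. Floating point assumptions: all matrix elements are normalized real floating point numbers; $u$ is the unit roundoff and $nu<1$; no operation underflows or overflows; $\mathrm{fl}[\cdot]$ denotes the result computed in floating point arithmetic. For $\mathrm{op}\in\{+,-,\times,/\}$ and normalized real floating point numbers $x,y$ such that $x\ \mathrm{op}\ y$ does not underflow or overflow, $\mathrm{fl}[x\ \mathrm{op}\ y]=(x\ \mathrm{op}\ y)(1+\delta)$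 for some $|\delta|\le u$, and also $\mathrm{fl}[x\ \mathrm{op}\ y]=(x\ \mathrm{op}\ y)/(1+\epsilon)$ for some $|\epsilon|\le u$. $\gamma_m=\frac{mu}{1-mu}$, where $mu<1$ is understood for every $\gamma_m$ that occurs. The computed value $\mathrm{fl}[\text{sum of products}]$ means: each product of several numbers is computed by successive floating point multiplications, and the computed products are then added in floating point from left to right (in the order $m=1,2,\ldots$, with the product not involving a $\hat c$ added last). $\hat c_j^{(i)}$ denotes the floating point computed value of $c_j^{(i)}$, with error $e_j^{(i)}=\hat c_j^{(i)}-c_j^{(i)}$. The values for $j=1,2$ are computed by $\hat c_1^{(1)}=c_1^{(1)}=-\alpha_1$ (exact, so $e_1^{(1)}=0$), $\hat{c}_1^{(i)}=\mathrm{fl}[\hat{c}_1^{(i-1)}-\alpha_i]$ for $2\le i\le n$, $\hat c_2^{(2)}=\mathrm{fl}[\mathrm{fl}[\alpha_1\alpha_2]-\mathrm{fl}[h_{12}\beta_2]]$, and $\hat c_2^{(i)}=\mathrm{fl}[\mathrm{fl}[\hat c_2^{(i-1)}-\mathrm{fl}[\alpha_i\hat c_1^{(i-1)}]]-\mathrm{fl}[h_{i-1,i}\beta_i]]$ for $3\le i\le n$. *)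

(* Defs.v *)
From HB Require Import structures.
From mathcomp Require Import all_boot all_order all_algebra.
From mathcomp Require Import reals.

Set Implicit Arguments.
Unset Strict Implicit.
Unset Printing Implicit Defensive.

Import Order.TTheory GRing.Theory Num.Theory.
Local Open Scope ring_scope.

Variant fp_op := FAdd | FSub | FMul | FDiv.

Definition exact_op (R : realType) (o : fp_op) (x y : R) : R :=
  match o with
  | FAdd => x + y
  | FSub => x - y
  | FMul => x * y
  | FDiv => x / y
  end.

(* The standard model of floating point arithmetic. [no_exception o x y] says
   that [x o y] neither underflows nor overflows; the model promises nothing
   about operations for which it fails, so a bounded exponent range is
   allowed. Zero counts as a normalized number as soon as a matrix entry or a
   computed result is zero. Closure of [normalized] under negation (a change
   of the sign bit) makes [- fl[..]] an exact operation. *)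
Record fp_arith (R : realType) := FPArith {
  normalized : R -> Prop;
  unit_roundoff : R;
  no_exception : fp_op -> R -> R -> Prop;
  fl_op : fp_op -> R -> R -> R;
  unit_roundoff_gt0 : 0 < unit_roundoff;
  normalizedN : forall x, normalized x -> normalized (- x);
  normalized_fl_op : forall o x y, normalized x -> normalized y ->
    (o = FDiv -> y != 0) -> no_exception o x y -> normalized (fl_op o x y);
  fl_op_mul : forall o x y, normalized x -> normalized y ->
    (o = FDiv -> y != 0) -> no_exception o x y ->
    exists2 delta : R, `|delta| <= unit_roundoff &
      fl_op o x y = exact_op o x y * (1 + delta);
  fl_op_div : forall o x y, normalized x -> normalized y ->
    (o = FDiv -> y != 0) -> no_exception o x y ->
    exists2 eps : R, `|eps| <= unit_roundoff &
      fl_op o x y = exact_op o x y / (1 + eps)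
}.

Inductive fp_expr (R : Type) :=
| FLit of R
| FBin of fp_op & fp_expr R & fp_expr R.

Declare Scope fp_scope.
Delimit Scope fp_scope with FP.
Bind Scope fp_scope with fp_expr.
Notation "x %:fp" := (FLit x) (at level 2, left associativity, format "x %:fp")
  : fp_scope.
Notation "e + f" := (FBin FAdd e f) : fp_scope.
Notation "e - f" := (FBin FSub e f) : fp_scope.
Notation "e * f" := (FBin FMul e f) : fp_scope.

(* The value fl[e]: every operation of [e] is carried out in floating point. *)
Fixpoint fl (R : realType) (A : fp_arith R) (e : fp_expr R) : R :=
  match e with
  | FLit x => x
  | FBin o e1 e2 => fl_op A o (fl A e1) (fl A e2)
  end.

Fixpoint exception_free (R : realType) (A : fp_arith R) (e : fp_expr R) : Prop :=
  match e with
  | FLit _ => True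
  | FBin o e1 e2 => [/\ exception_free A e1, exception_free A e2
                      & no_exception A o (fl A e1) (fl A e2)]
  end.

(* [product_expr s e]: [e] multiplies together the factors listed in [s], one
   multiplication per additional factor, in an arbitrary order (floating point
   multiplication is not associative, and no order is prescribed). *)
Inductive product_expr (R : realType) : seq R -> fp_expr R -> Prop :=
| ProductOne x : product_expr [:: x] (FLit x)
| ProductMul s1 s2 s e1 e2 :
    product_expr s1 e1 -> product_expr s2 e2 -> perm_eq s (s1 ++ s2) ->
    product_expr s (e1 * e2)%FP.

(* [sum_expr ss e]: [e] adds the products of the lists in [ss], from left to
   right. *)
Inductive sum_expr (R : realType) : seq (seq R) -> fp_expr R -> Prop :=
| SumOne s e : product_expr s e -> sum_expr [:: s] e
| SumAdd ss s e f : sum_expr ss e -> product_expr s f ->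
    sum_expr (rcons ss s) (e + f)%FP.

Definition gamma (R : realType) (u : R) (m : nat) : R :=
  m%:R * u / (1 - m%:R * u).

(* Entry h_{ij} in 1-based indexing; only used for 1 <= i, j <= n. *)
Definition entry (R : realType) (n : nat) (H : 'M[R]_n) (i j : nat) : R :=
  match (insub i.-1 : option 'I_n), (insub j.-1 : option 'I_n) with
  | Some a, Some b => H a b
  | _, _ => 0
  end.

Definition alpha (R : realType) (n : nat) (H : 'M[R]_n) (i : nat) : R :=
  entry H i i.

Definition beta (R : realType) (n : nat) (H : 'M[R]_n) (i : nat) : R :=
  entry H i i.-1.

Definition upper_hessenberg (R : realType) (n : nat) (H : 'M[R]_n) : Prop :=
  forall a b : 'I_n, (b.+1 < a)%N -> H a b = 0.

Definition leading_submx (R : realType) (n : nat) (H : 'M[R]_n) (i : nat) :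
    'M[R]_i :=
  \matrix_(a < i, b < i) entry H a.+1 b.+1.

(* c_j^{(i)}, the coefficient of lambda^(i-j) in det(lambda I - H_i). *)
Definition cpcoef (R : realType) (n : nat) (H : 'M[R]_n) (i j : nat) : R :=
  (char_poly (leading_submx H i))`_(i - j).

(* e_j^{(i)}, where [chat i j] stands for the computed value of c_j^{(i)}. *)
Definition cperr (R : realType) (n : nat) (H : 'M[R]_n)
    (chat : nat -> nat -> R) (i j : nat) : R :=
  chat i j - cpcoef H i j.

(* The m numbers beta_{i-m+1}, ..., beta_i, and their exact product. *)
Definition betas (R : realType) (n : nat) (H : 'M[R]_n) (i m : nat) : seq R :=
  [seq beta H l | l <- index_iota (i - m + 1) i.+1].

Definition betaprod (R : realType) (n : nat) (H : 'M[R]_n) (i m : nat) : R :=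
  \prod_(i - m + 1 <= l < i.+1) beta H l.

(* The factors of the successive terms of
     sum_{m=1}^{j-2} h_{i-m,i} beta_i...beta_{i-m+1} chat_{j-m-1}^{(i-m-1)}
       + h_{i-j+1,i} beta_i...beta_{i-j+2};
   for j = i the last term is h_{1,i} beta_i...beta_2. *)
Definition inner_terms (R : realType) (n : nat) (H : 'M[R]_n)
    (chat : nat -> nat -> R) (i j : nat) : seq (seq R) :=
  rcons
    [seq rcons (entry H (i - m) i :: betas H i m) (chat (i - m - 1)%N (j - m - 1)%N)
       | m <- index_iota 1 (j - 1)]
    (entry H (i - j + 1) i :: betas H i (j - 1)).

(* Main.v *)
Require Import Defs.
From HB Require Import structures.
From mathcomp Require Import all_boot all_order all_algebra.
From mathcomp Require Import reals.
From mathcomp Require Import zify ring lra.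

Set Implicit Arguments.
Unset Strict Implicit.
Unset Printing Implicit Defensive.

Import Order.TTheory GRing.Theory Num.Theory.
Local Open Scope ring_scope.

(* Expanding det(lambda I - H_i) along its last row, whose only nonzero entries
   are the last two, expresses it through determinants of the same shape with a
   prescribed last column; unrolling this gives the recurrence for the exact
   coefficients. On the floating point side, a computed value that went through
   m operations carries a factor between (1 - u)^m and (1 + u)^m, hence within
   gamma_m of 1. In the inner sum the term of index m undergoes m + 1
   multiplications, followed by j - m additions if m >= 2 and j - 2 if m = 1;
   the last term undergoes j - 1 multiplications and one addition. This yields
   the factors gamma_(j+1) and gamma_j. The outermost operation is read in the
   form fl[x op y] (1 + eps) = x op y, so that its error is u times a computed
   value. *)

(** * Hessenberg determinants with a free last column *)

(** The column [w] is arbitrary so that the induction closes: deleting the last row and the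
    next-to-last column makes [w] the last column of a smaller matrix of the same kind. *)
Lemma det_hessenberg_last_col (S : comNzRingType) (M : nat -> nat -> S)
    (w : nat -> S) (n : nat) :
  (forall a b, (b.+1 < a)%N -> M a b = 0) ->
  \det (\matrix_(a < n.+1, b < n.+1) if b == n :> nat then w a else M a b) =
  \sum_(l < n.+1) (\prod_(l <= q < n) - M q.+1 q) * w l *
    \det (\matrix_(a < l, b < l) M a b).
Proof.
move=> M0; elim: n => [|n IHn].
  rewrite big_ord1 big_geq // mul1r det_mx11 mxE /= -[LHS]mulr1; congr (_ * _).
  by rewrite det_mx00.
have row'_lt (m : nat) (b : 'I_m) : (lift ord_max b : nat) = b by rewrite lift_max.
rewrite (expand_det_row _ ord_max) big_ord_recr big_ord_recr /= big1 ?add0r; last first.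
  move=> b _; have hb := ltn_ord b.
  by rewrite !mxE /= ifN ?M0 ?mul0r //; lia.
rewrite [RHS]big_ord_recr /= big_geq // mul1r; congr (_ + _).
  rewrite !mxE /= ifN; last lia.
  (* The position is next to the diagonal, hence the sign -1. In the minor, columns before [n] are
     unchanged and column [n] is the former column [n.+1], that is [w]. *)
  set C := cofactor _ _ _; have {C}-> : C =
      - \det (\matrix_(a < n.+1, b < n.+1) if b == n :> nat then w a else M a b).
    rewrite /C /cofactor -signr_odd (_ : odd _ = true) ?expr1 ?mulN1r; last by rewrite /=; lia.
    congr (- \det _); apply/matrixP=> a b; rewrite !mxE row'_lt /=.
    have hb := ltn_ord b; rewrite /bump; case: (ltngtP b n) => hbn.
    - by rewrite /= add0n ltn_eqF // ltnW.
    - by lia.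
    - by rewrite hbn add1n eqxx.
  rewrite mulrN -mulNr IHn mulr_sumr; apply: eq_bigr => l _.
  rewrite big_nat_recr /=; last by rewrite -ltnS.
  by rewrite !mulrA; congr (_ * _ * _); rewrite mulrC.
rewrite !mxE eqxx; congr (_ * _).
rewrite /cofactor /= addnn -signr_odd odd_double expr0 mul1r.
congr (\det _); apply/matrixP=> a b; rewrite !mxE !row'_lt ifN //.
by rewrite ltn_eqF.
Qed.

(** * Recurrences for the exact coefficients *)

Section CharPolyCoefficients.
Variables (R : realType) (n : nat) (H : 'M[R]_n).

(** Outside the matrix [entry] takes its default value 0, so the vanishing extends to all natural
    indices, as [det_hessenberg_last_col] asks. *)
Lemma entry_hessenberg (a b : nat) :
  upper_hessenberg H -> (b.+1 < a)%N -> entry H a.+1 b.+1 = 0.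
Proof.
rewrite /entry /= => H0 ltba.
case: insubP => [a' _ Ea|//]; case: insubP => [b' _ Eb|//].
by apply: H0; rewrite Ea Eb.
Qed.

Definition cpoly (i : nat) : {poly R} := char_poly (leading_submx H i).

(** The determinant expansion is applied with the actual last column as [w]: its top index gives the
    diagonal factor, and a lower index l gives the term m = i - l - 1. *)
Lemma cpoly_rec (i : nat) : upper_hessenberg H -> (0 < i)%N ->
  cpoly i = ('X - (alpha H i)%:P) * cpoly i.-1
    - \sum_(1 <= m < i) (entry H (i - m) i * betaprod H i m)%:P * cpoly (i - m - 1).
Proof.
case: i => // i H0 _; pose M a b : {poly R} := 'X *+ (a == b) - (entry H a.+1 b.+1)%:P.
have cpolyE l : cpoly l = \det (\matrix_(a < l, b < l) M a b).
  by congr (\det _); apply/matrixP=> a b; rewrite !mxE.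
have M0 a b : (b.+1 < a)%N -> M a b = 0.
  move=> ltba; rewrite /M entry_hessenberg // gtn_eqF ?subrr //.
  exact: leq_trans ltba.
have Mlast : cpoly i.+1 =
    \det (\matrix_(a < i.+1, b < i.+1) if b == i :> nat then M a i else M a b).
  rewrite cpolyE; congr (\det _); apply/matrixP=> a b; rewrite !mxE.
  by case: eqP => // ->.
rewrite Mlast (det_hessenberg_last_col (fun a => M a i)) // big_ord_recr /=.
have Mii : M i i = 'X - (alpha H i.+1)%:P by rewrite /M eqxx.
rewrite big_geq // mul1r -!cpolyE Mii addrC; congr (_ + _).
rewrite -sumrN big_add1 /= big_mkord (reindex_inj rev_ord_inj) /=.
apply: eq_bigr => m _; have hm := ltn_ord m.
have -> : (i.+1 - m.+1 - 1 = i - m.+1)%N by lia.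
rewrite -cpolyE -mulNr; congr (_ * _).
rewrite /M (_ : (i - m.+1 == i)%N = false) /=; last lia.
rewrite sub0r mulrN; congr (- _); rewrite mulrC rmorphM /=; congr (_ * _).
  by congr (entry _ _ _)%:P; lia.
rewrite /betaprod rmorph_prod /=.
have -> : (i.+1 - m.+1 + 1 = (i - m.+1).+2)%N by lia.
(* Below the diagonal [M] is minus a [beta], which cancels the sign in [- M q.+1 q]. *)
rewrite big_add1 big_add1 /=; apply: eq_big_nat => q hq.
by rewrite gtn_eqF //= sub0r opprK.
Qed.

Lemma size_cpoly (i : nat) : size (cpoly i) = i.+1.
Proof. exact: size_char_poly. Qed.

Lemma cpoly_lead (i : nat) : (cpoly i)`_i = 1.
Proof.
by have /monicP := char_poly_monic (leading_submx H i); rewrite lead_coefE size_char_poly.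
Qed.

(* The terms with [m > j - 1] vanish for degree reasons, and [m = j - 1]
   contributes a leading coefficient 1. *)
Lemma coef_hessenberg_sum (i j : nat) : (2 <= j <= i)%N ->
  (\sum_(1 <= m < i) (entry H (i - m) i * betaprod H i m)%:P
      * cpoly (i - m - 1))`_(i - j) =
  \sum_(1 <= m < j - 1) entry H (i - m) i * betaprod H i m
      * cpcoef H (i - m - 1) (j - m - 1)
  + entry H (i - j + 1) i * betaprod H i (j - 1).
Proof.
case: j => // j hj; have -> : (j.+1 - 1 = j)%N by rewrite subn1.
rewrite coef_sum (@big_cat_nat _ _ _ j.+1) /=; [|lia|lia].
rewrite [X in _ + X]big_nat_cond [X in _ + X]big1 ?addr0; last first.
  move=> m; rewrite andbT => hm; rewrite coefCM nth_default ?mulr0 //.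
  by rewrite size_cpoly; lia.
rewrite big_nat_recr /=; last lia.
congr (_ + _).
  (* Order and index both drop by m + 1, so the degree at which the coefficient is read does not
     change. *)
  apply: eq_big_nat => m hm; rewrite coefCM; congr (_ * _).
  by rewrite /cpcoef -/(cpoly _); congr (_`_ _); lia.
rewrite coefCM.
have -> : (i - j.+1 = i - j - 1)%N by lia.
by rewrite cpoly_lead mulr1; congr (entry _ _ _ * _); lia.
Qed.

(** The diagonal case is separate: multiplication by ['X] contributes no constant coefficient,
    whereas [cpcoef H (i - 1) i] would, by truncated subtraction, return a constant coefficient
    instead of 0. *)
Lemma cpcoef_diag (i : nat) : upper_hessenberg H -> (2 <= i)%N ->
  cpcoef H i i = - (alpha H i * cpcoef H (i - 1) (i - 1))
    - (\sum_(1 <= m < i - 1) entry H (i - m) i * betaprod H i m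
         * cpcoef H (i - m - 1) (i - m - 1)
       + entry H 1 i * betaprod H i (i - 1)).
Proof.
move=> H0 hi; rewrite {1}/cpcoef -/(cpoly i) cpoly_rec //; last lia.
rewrite coefB coef_hessenberg_sum ?hi ?leqnn // subnn add0n; congr (_ - _).
rewrite mulrBl coefB coefXM eqxx sub0r coefCM /cpcoef -/(cpoly _) subnn.
by rewrite subn1.
Qed.

Lemma cpcoef_offdiag (i j : nat) : upper_hessenberg H -> (2 <= j < i)%N ->
  cpcoef H i j = cpcoef H (i - 1) j - alpha H i * cpcoef H (i - 1) (j - 1)
    - (\sum_(1 <= m < j - 1) entry H (i - m) i * betaprod H i m
         * cpcoef H (i - m - 1) (j - m - 1)
       + entry H (i - j + 1) i * betaprod H i (j - 1)).
Proof.
move=> H0 hj; rewrite {1}/cpcoef -/(cpoly i) cpoly_rec //; last lia.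
rewrite coefB coef_hessenberg_sum; last lia.
congr (_ - _); rewrite mulrBl coefB coefXM coefCM ifN; last lia.
rewrite /cpcoef -!/(cpoly _) -[i.-1]subn1.
by congr ((cpoly _)`_ _ - _ * (cpoly _)`_ _); lia.
Qed.

End CharPolyCoefficients.

(** * Accumulated rounding factors and gamma *)

Section RoundoffFactors.
Variables (R : realType) (u : R).
Hypotheses (u_ge0 : 0 <= u) (u_lt1 : u < 1).

(** An interval stands in for a product of m factors 1 + delta: under multiplication the exponents
    add, and no list of deltas has to be tracked. *)
Definition roundoff_factor (m : nat) (t : R) : Prop :=
  (1 - u) ^+ m <= t <= (1 + u) ^+ m.

Lemma roundoff_factor1 : roundoff_factor 0 1.
Proof. by rewrite /roundoff_factor !expr0 lexx. Qed.

Lemma roundoff_factorD (d : R) : `|d| <= u -> roundoff_factor 1 (1 + d).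
Proof. by rewrite ler_norml /roundoff_factor !expr1 !lerD2l. Qed.

Lemma oneD_gt0 (d : R) : `|d| <= u -> 0 < 1 + d.
Proof. by rewrite ler_norml => /andP[ud _]; move: u_lt1 ud; lra. Qed.

Lemma roundoff_factorM (m1 m2 : nat) (t1 t2 : R) :
  roundoff_factor m1 t1 -> roundoff_factor m2 t2 ->
  roundoff_factor (m1 + m2) (t1 * t2).
Proof.
move=> /andP[l1 r1] /andP[l2 r2]; rewrite /roundoff_factor !exprD.
have u1 m : 0 <= (1 - u) ^+ m by rewrite exprn_ge0 // subr_ge0 ltW.
have t1_ge0 := le_trans (u1 m1) l1; have t2_ge0 := le_trans (u1 m2) l2.
by rewrite !ler_pM.
Qed.

(** Bernoulli's inequality; the induction step discards the nonnegative term m u^2. *)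
Lemma exprB1_ge (m : nat) : 1 - m%:R * u <= (1 - u) ^+ m.
Proof.
elim: m => [|m IHm]; first by rewrite mul0r subr0 expr0.
rewrite exprS; apply: (@le_trans _ _ ((1 - u) * (1 - m%:R * u))); last first.
  by rewrite ler_wpM2l // subr_ge0 ltW.
have : 0 <= m%:R * (u * u) by rewrite !mulr_ge0.
by rewrite -natr1; nra.
Qed.

(* (1 + u)^m (1 - mu) <= (1 + u)^m (1 - u)^m = (1 - u^2)^m <= 1. *)
Lemma exprD1_le (m : nat) : (1 + u) ^+ m * (1 - m%:R * u) <= 1.
Proof.
apply: (@le_trans _ _ ((1 + u) ^+ m * (1 - u) ^+ m)).
  by rewrite ler_wpM2l ?exprB1_ge // exprn_ge0 // addr_ge0.
have uu : 0 <= u * u by exact: mulr_ge0.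
rewrite -exprMn exprn_ile1 //; last by lra.
by apply: mulr_ge0; [exact: addr_ge0 | rewrite subr_ge0 ltW].
Qed.

(** Above, (1 + u)^m is at most 1 / (1 - mu) = 1 + gamma_m; below, (1 - u)^m is at least 1 - mu, and
    mu is at most gamma_m. *)
Lemma roundoff_factor_gamma (m : nat) (t : R) : m%:R * u < 1 ->
  roundoff_factor m t -> `|t - 1| <= gamma u m.
Proof.
rewrite -subr_gt0 => mu1 /andP[lt rt].
have mu0 : 0 <= m%:R * u by rewrite mulr_ge0.
have gE : gamma u m = (1 - m%:R * u)^-1 - 1.
  by rewrite /gamma; field; rewrite gt_eqF.
have mu_gamma : m%:R * u <= gamma u m.
  by rewrite /gamma ler_pdivlMr //; nra.
rewrite ler_norml; apply/andP; split.
  by have := exprB1_ge m; lra.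
rewrite gE lerD2r (le_trans rt) // -[leRHS]mul1r ler_pdivlMr //.
exact: exprD1_le.
Qed.

End RoundoffFactors.

(** * Rounding errors of products, sums and the inner sum *)

Section FloatingPointExpressions.
Variables (R : realType) (A : fp_arith R).
Local Notation u := (unit_roundoff A).
Hypothesis u_lt1 : u < 1.
Let u_ge0 : 0 <= u := ltW (unit_roundoff_gt0 A).

(** Every multiplication order uses one operation fewer than there are factors. Normality is part of
    the induction because the rounding model speaks only of normalized operands. *)
Lemma fl_product (s : seq R) (e : fp_expr R) : product_expr s e ->
  {in s, forall x, normalized A x} -> exception_free A e ->
  [/\ (0 < size s)%N, normalized A (fl A e) &
    exists2 t, roundoff_factor u (size s).-1 t & fl A e = (\prod_(x <- s) x) * t].
Proof.
elim=> [x|s1 s2 s' e1 e2 _ IH1 _ IH2 s12] Ns.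
  split=> //; first by apply: Ns; rewrite inE.
  by exists 1; [exact: roundoff_factor1|rewrite big_seq1 mulr1].
case=> /= ex1 ex2 ex12.
have [|s1_gt0 n1 [t1 r1 E1]] := IH1 _ ex1.
  by move=> x xs1; apply: Ns; rewrite (perm_mem s12) mem_cat xs1.
have [|s2_gt0 n2 [t2 r2 E2]] := IH2 _ ex2.
  by move=> x xs2; apply: Ns; rewrite (perm_mem s12) mem_cat xs2 orbT.
have [d du Ed] := @fl_op_mul _ A FMul _ _ n1 n2 (fun E => ltac:(discriminate E)) ex12.
rewrite (perm_size s12) size_cat; split; first by rewrite addn_gt0 s1_gt0.
  exact: normalized_fl_op.
exists (t1 * t2 * (1 + d)).
  have -> : (size s1 + size s2).-1 = ((size s1).-1 + (size s2).-1 + 1)%N by lia.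
  by apply: roundoff_factorM => //; [exact: roundoff_factorM|exact: roundoff_factorD].
rewrite Ed /= E1 E2 (perm_big _ s12) big_cat /=; ring.
Qed.

(* The first two of the N terms take part in N - 1 additions, the later term
   of index p (counted from 0) in N - p. *)
Lemma fl_sum (ss : seq (seq R)) (e : fp_expr R) : sum_expr ss e ->
  (forall s, s \in ss -> {in s, forall x, normalized A x}) -> exception_free A e ->
  [/\ (0 < size ss)%N, normalized A (fl A e) &
    exists2 t : nat -> R,
      forall p, (p < size ss)%N ->
        roundoff_factor u ((size (nth [::] ss p)).-1 + (size ss - maxn p 1)) (t p) &
      fl A e = \sum_(p < size ss) (\prod_(x <- nth [::] ss p) x) * t p].
Proof.
elim=> [s f Pf|ss' s f g _ IH Pg] Ns.
  move=> exf; have [|_ nf [t rt Et]] := fl_product Pf _ exf.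
    by apply: Ns; rewrite inE.
  split=> //; exists (fun _ => t); last by rewrite big_ord1.
  by case=> //= _; rewrite addn0.
case=> /= exf exg exfg.
have [|ss_gt0 nf [t rt Et]] := IH _ exf.
  by move=> s' ss's; apply: Ns; rewrite mem_rcons inE ss's orbT.
have [|_ ng [t' rt' Et']] := fl_product Pg _ exg.
  by apply: Ns; rewrite mem_rcons inE eqxx.
have [d du Ed] := @fl_op_mul _ A FAdd _ _ nf ng (fun E => ltac:(discriminate E)) exfg.
rewrite size_rcons; split=> //; first exact: normalized_fl_op.
(* The final addition multiplies both operands by the same 1 + d: older terms gain one rounding, and
   the new term has its own product factor [t'] and this one. *)
exists (fun p => (if (p < size ss')%N then t p else t') * (1 + d)).
  move=> p; rewrite ltnS nth_rcons leq_eqVlt => /orP[/eqP->|lt_p].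
    rewrite ltnn eqxx (_ : (_.+1 - _ = 1)%N); last lia.
    by apply: roundoff_factorM => //; exact: roundoff_factorD.
  rewrite lt_p (_ : (_.+1 - _ = size ss' - maxn p 1 + 1)%N); last lia.
  by rewrite addnA; apply: roundoff_factorM => //; [exact: rt|exact: roundoff_factorD].
rewrite Ed /= Et Et' big_ord_recr /= nth_rcons ltnn eqxx mulrDl mulr_suml.
rewrite mulrA; congr (_ + _); apply: eq_bigr => p _.
by rewrite nth_rcons ltn_ord mulrA.
Qed.

Lemma fl_opN_div (o : fp_op) (x y : R) : normalized A x -> normalized A y ->
  (o = FDiv -> y != 0) -> no_exception A o x y ->
  exists2 eps, `|eps| <= u & fl_op A o x y * (1 + eps) = exact_op o x y.
Proof.
move=> nx ny y0 exc; have [eps epsu E] := fl_op_div nx ny y0 exc.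
by exists eps => //; rewrite E divfK // gt_eqF // (oneD_gt0 u_lt1).
Qed.

Lemma normalized_fl_bin (o : fp_op) (e f : fp_expr R) : o <> FDiv ->
  (exception_free A e -> normalized A (fl A e)) ->
  (exception_free A f -> normalized A (fl A f)) ->
  exception_free A (FBin o e f) -> normalized A (fl A (FBin o e f)).
Proof. by move=> oD ne nf /= [/ne ? /nf ? ?]; exact: normalized_fl_op. Qed.

Variables (n : nat) (H : 'M[R]_n) (chat : nat -> nat -> R).

(** The bounds exclude the default value 0 of [entry], since 0 is not assumed normalized. *)
Lemma normalized_entry (i j : nat) : (forall a b, normalized A (H a b)) ->
  (0 < n)%N -> (i <= n)%N -> (j <= n)%N -> normalized A (entry H i j).
Proof.
move=> nH n_gt0 hi hj; rewrite /entry.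
case: insubP => [a _ _|]; last by lia.
by case: insubP => [b _ _|]; [exact: nH|lia].
Qed.

(** Only coefficients of order below [i] are assumed normalized, so that the lemma can serve inside
    an induction on the order. *)
Lemma normalized_inner_terms (i j : nat) : (forall a b, normalized A (H a b)) ->
  (2 <= j <= i)%N -> (i <= n)%N ->
  (forall l m, (l < i)%N -> (0 < m < j)%N -> (m <= l)%N -> normalized A (chat l m)) ->
  forall s, s \in inner_terms H chat i j -> {in s, forall x, normalized A x}.
Proof.
move=> nH hj hi nc.
have nbeta m x : x \in betas H i m -> normalized A x.
  by move=> /mapP[l]; rewrite mem_index_iota => hl ->; apply: normalized_entry => //; lia.
move=> s; rewrite mem_rcons in_cons => /orP[/eqP->|/mapP[m]].
  move=> x; rewrite in_cons => /orP[/eqP->|/nbeta//].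
  by apply: normalized_entry => //; lia.
rewrite mem_index_iota => hm -> x.
rewrite mem_rcons !in_cons => /or3P[/eqP->|/eqP->|/nbeta//].
  by apply: nc; lia.
by apply: normalized_entry => //; lia.
Qed.

(** Only the roundoff of the inner sum is measured: the reference value uses the computed
    coefficients, whose own errors enter through [inner_sum_cperr]. *)
Lemma fl_inner_terms (i j : nat) (S : fp_expr R) : (3 <= j <= i)%N ->
  (j + 1)%:R * u < 1 ->
  (forall s, s \in inner_terms H chat i j -> {in s, forall x, normalized A x}) ->
  sum_expr (inner_terms H chat i j) S -> exception_free A S ->
  normalized A (fl A S) /\
  `|fl A S - (\sum_(1 <= m < j - 1) entry H (i - m) i * betaprod H i m
                  * chat (i - m - 1)%N (j - m - 1)%N
              + entry H (i - j + 1) i * betaprod H i (j - 1))|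
  <= gamma u (j + 1) * \sum_(2 <= m < j - 1)
           `|entry H (i - m) i * betaprod H i m * chat (i - m - 1)%N (j - m - 1)%N|
     + gamma u j * (`|entry H (i - 1) i * beta H i * chat (i - 2)%N (j - 2)%N|
           + `|entry H (i - j + 1) i * betaprod H i (j - 1)|).
Proof.
move=> hj ju1 nS sumS exS; have [_ nflS [t rt flE]] := fl_sum sumS nS exS.
split=> //; rewrite {}flE.
set T := fun m => entry H (i - m) i * betaprod H i m * chat (i - m - 1)%N (j - m - 1)%N.
set L := entry H (i - j + 1) i * betaprod H i (j - 1).
have prod_cons x s : \prod_(y <- x :: s) y = x * \prod_(y <- s) y by rewrite big_cons.
have size_betas m : (m <= i)%N -> size (betas H i m) = m.
  by move=> hm; rewrite size_map size_iota; lia.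
have prod_betas m : \prod_(y <- betas H i m) y = betaprod H i m by rewrite big_map.
have sz : size (inner_terms H chat i j) = (j - 1)%N.
  by rewrite size_rcons size_map size_iota; lia.
have nthT p : (p < j - 2)%N ->
    nth [::] (inner_terms H chat i j) p =
    rcons (entry H (i - p.+1) i :: betas H i p.+1) (chat (i - p.+1 - 1)%N (j - p.+1 - 1)%N).
  move=> hp; rewrite nth_rcons size_map size_iota ifT; last lia.
  by rewrite (nth_map 0%N) ?size_iota ?nth_iota ?add1n //; lia.
have nthL : nth [::] (inner_terms H chat i j) (j - 2) =
    entry H (i - j + 1) i :: betas H i (j - 1).
  rewrite nth_rcons size_map size_iota ifN; last lia.
  by rewrite ifT //; lia.
have prodT p : (p < j - 2)%N ->
    \prod_(x <- nth [::] (inner_terms H chat i j) p) x = T p.+1.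
  move=> hp; rewrite nthT // -cats1 big_cat big_seq1 /= prod_cons prod_betas //.
have prodL : \prod_(x <- nth [::] (inner_terms H chat i j) (j - 2)) x = L.
  by rewrite nthL prod_cons prod_betas.
have gle m v : (m <= j + 1)%N -> roundoff_factor u m v -> `|v - 1| <= gamma u m.
  move=> hm; apply: roundoff_factor_gamma => //.
  by apply: le_lt_trans ju1; rewrite ler_wpM2r // ler_nat.
(* Position [p] holds the term m = p + 1, with p + 3 factors: p + 2 multiplications and j - 1 - p
   additions. *)
have gT p : (0 < p < j - 2)%N -> `|T p.+1 * (t p - 1)| <= gamma u (j + 1) * `|T p.+1|.
  move=> hp; rewrite normrM mulrC ler_wpM2r // gle //.
  have := rt p; rewrite sz nthT ?size_rcons /= ?size_betas //; try lia.
  have -> : (p.+2 + (j - 1 - maxn p 1) = j + 1)%N by lia.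
  by apply; lia.
have gT0 : `|T 1%N * (t 0%N - 1)| <= gamma u j * `|T 1%N|.
  rewrite normrM mulrC ler_wpM2r // gle //; first lia.
  have := rt 0%N; rewrite sz nthT ?size_rcons /= ?size_betas //; try lia.
  have -> : (2 + (j - 1 - maxn 0 1) = j)%N by lia.
  by apply; lia.
have gL : `|L * (t (j - 2)%N - 1)| <= gamma u j * `|L|.
  rewrite normrM mulrC ler_wpM2r // gle //; first lia.
  have := rt (j - 2)%N; rewrite sz nthL /= ?size_betas //; try lia.
  have -> : (j - 1 + (j - 1 - maxn (j - 2) 1) = j)%N by lia.
  by apply; lia.
have T1E : entry H (i - 1) i * beta H i * chat (i - 2)%N (j - 2)%N = T 1%N.
  rewrite /T /betaprod subnK ?big_nat1; last lia.
  by congr (_ * chat _ _); lia.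
rewrite T1E sz -(big_mkord xpredT
  (fun p => (\prod_(x <- nth [::] (inner_terms H chat i j) p) x) * t p)).
(* The first and last terms, with their smaller factor gamma_j, are split off; the [j - 3] middle
   terms remain, none of them if j = 3. *)
have jE : (j - 1 = (j - 3).+2)%N by lia.
have j2E : (j - 2 = (j - 3).+1)%N by lia.
move: prodL gL; rewrite j2E => prodL gL.
rewrite [X in \sum_(0 <= p < X) _]jE big_nat_recr //= big_nat_recl //= prodL.
rewrite !jE !(big_add1, succnK) /= big_nat_recl //= prodT; last lia.
rewrite [X in _ - (_ + X + _)](_ : _ = \sum_(0 <= m < j - 3) T m.+2) //.
rewrite [X in _ + X + _ - _](_ : _ =
  \sum_(0 <= m < j - 3) T m.+2 + \sum_(0 <= m < j - 3) T m.+2 * (t m.+1 - 1)); last first.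
  rewrite -big_split /=; apply: eq_big_nat => p hp.
  by rewrite prodT; [ring|lia].
set T2 := \sum_(_ <= _ < _) T _; set G := \sum_(_ <= _ < _) T _ * _.
have gG : `|G| <= gamma u (j + 1) * \sum_(0 <= m < j - 3) `|T m.+2|.
  apply: le_trans (ler_norm_sum _ _ _) _; rewrite mulr_sumr !big_nat.
  by apply: ler_sum => p hp; apply: gT; lia.
rewrite [X in `|X|](_ : _ =
  G + (T 1%N * (t 0%N - 1) + L * (t (j - 3).+1 - 1))); last by rewrite -/(T 1%N); ring.
apply: (le_trans (ler_normD _ _)); apply: lerD; first exact: gG.
by rewrite [leRHS]mulrDr; apply: (le_trans (ler_normD _ _)); exact: (lerD gT0 gL).
Qed.

(** Triangle inequality through the sum with computed coefficients; the two sums differ by the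
    [cperr] terms, and [L] cancels. *)
Lemma inner_sum_cperr (i j : nat) (F L : R) :
  `|F - (\sum_(1 <= m < j - 1) entry H (i - m) i * betaprod H i m
           * cpcoef H (i - m - 1) (j - m - 1) + L)| <=
  \sum_(1 <= m < j - 1)
    `|entry H (i - m) i * betaprod H i m * cperr H chat (i - m - 1) (j - m - 1)| +
  `|F - (\sum_(1 <= m < j - 1) entry H (i - m) i * betaprod H i m
           * chat (i - m - 1)%N (j - m - 1)%N + L)|.
Proof.
have -> : \sum_(1 <= m < j - 1) entry H (i - m) i * betaprod H i m
        * cpcoef H (i - m - 1) (j - m - 1) =
    \sum_(1 <= m < j - 1) entry H (i - m) i * betaprod H i m
        * chat (i - m - 1)%N (j - m - 1)%N
    - \sum_(1 <= m < j - 1) entry H (i - m) i * betaprod H i m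
        * cperr H chat (i - m - 1) (j - m - 1).
  by rewrite -sumrB; apply: eq_bigr => m _; rewrite /cperr; ring.
set T := \sum_(_ <= _ < _) _ * chat _ _; set E := \sum_(_ <= _ < _) _ * cperr _ _ _ _.
rewrite (_ : F - _ = E + (F - (T + L))); last by ring.
apply: (le_trans (ler_normD _ _)); rewrite lerD2r.
exact: ler_norm_sum.
Qed.

End FloatingPointExpressions.

(** * Assembly of the error bounds *)

Theorem theorem5p3 (R : realType) (A : fp_arith R) (n k : nat) (H : 'M[R]_n)
    (chat : nat -> nat -> R)
    (k_range : (3 <= k <= n)%N)
    (H_hess : upper_hessenberg H)
    (H_norm : forall a b : 'I_n, normalized A (H a b))
    (nu_lt1 : n%:R * unit_roundoff A < 1)
    (gamma_def : forall m : nat, (m <= k.+1)%N -> m%:R * unit_roundoff A < 1)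
    (chat11 : chat 1%N 1%N = - alpha H 1)
    (chat_i1 : forall i : nat, (2 <= i <= n)%N ->
       let e := ((chat (i - 1)%N 1%N)%:fp - (alpha H i)%:fp)%FP in
       exception_free A e /\ chat i 1%N = fl A e)
    (chat22 :
       let e := ((alpha H 1)%:fp * (alpha H 2)%:fp
                 - (entry H 1 2)%:fp * (beta H 2)%:fp)%FP in
       exception_free A e /\ chat 2%N 2%N = fl A e)
    (chat_i2 : forall i : nat, (3 <= i <= n)%N ->
       let e := ((chat (i - 1)%N 2%N)%:fp - (alpha H i)%:fp * (chat (i - 1)%N 1%N)%:fp
                 - (entry H (i - 1) i)%:fp * (beta H i)%:fp)%FP in
       exception_free A e /\ chat i 2%N = fl A e)
    (chat_ii : forall i : nat, (3 <= i <= k)%N ->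
       exists2 S : fp_expr R, sum_expr (inner_terms H chat i i) S &
         let e := ((alpha H i)%:fp * (chat (i - 1)%N (i - 1)%N)%:fp + S)%FP in
         exception_free A e /\ chat i i = - fl A e)
    (chat_ij : forall j i : nat, (3 <= j <= k)%N -> (j + 1 <= i <= n)%N ->
       exists2 S : fp_expr R, sum_expr (inner_terms H chat i j) S &
         let e := ((chat (i - 1)%N j)%:fp
                   - (alpha H i)%:fp * (chat (i - 1)%N (j - 1)%N)%:fp - S)%FP in
         exception_free A e /\ chat i j = fl A e) :
  (forall i : nat, (3 <= i <= k)%N ->
     `|cperr H chat i i| <=
       `|alpha H i * cperr H chat (i - 1) (i - 1)|
       + \sum_(1 <= m < i - 1)
           `|entry H (i - m) i * betaprod H i m
             * cperr H chat (i - m - 1) (i - m - 1)|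
       + gamma (unit_roundoff A) (i + 1) *
           \sum_(2 <= m < i - 1)
             `|entry H (i - m) i * betaprod H i m
               * chat (i - m - 1)%N (i - m - 1)%N|
       + gamma (unit_roundoff A) i *
           (`|entry H (i - 1) i * beta H i * chat (i - 2)%N (i - 2)%N|
            + `|entry H 1 i * betaprod H i (i - 1)|)
       + unit_roundoff A *
           (`|chat i i| + `|alpha H i * chat (i - 1)%N (i - 1)%N|)) /\
  (forall j i : nat, (3 <= j <= k)%N -> (j + 1 <= i <= n)%N ->
     `|cperr H chat i j| <=
       `|cperr H chat (i - 1) j|
       + `|alpha H i * cperr H chat (i - 1) (j - 1)|
       + \sum_(1 <= m < j - 1)
           `|entry H (i - m) i * betaprod H i m
             * cperr H chat (i - m - 1) (j - m - 1)|
       + gamma (unit_roundoff A) (j + 1) *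
           \sum_(2 <= m < j - 1)
             `|entry H (i - m) i * betaprod H i m
               * chat (i - m - 1)%N (j - m - 1)%N|
       + gamma (unit_roundoff A) j *
           (`|entry H (i - 1) i * beta H i * chat (i - 2)%N (j - 2)%N|
            + `|entry H (i - j + 1) i * betaprod H i (j - 1)|)
       + unit_roundoff A * (`|chat i j| + `|chat (i - 1)%N j|)
       + gamma (unit_roundoff A) 2 * `|alpha H i * chat (i - 1)%N (j - 1)%N|).

Proof.
set u := unit_roundoff A.
have n_gt0 : (0 < n)%N by lia.
have u_ge0 : 0 <= u := ltW (unit_roundoff_gt0 A).
have u_lt1 : u < 1.
  by apply: le_lt_trans nu_lt1; rewrite ler_peMl // ler1n.
have nE a b : (a <= n)%N -> (b <= n)%N -> normalized A (entry H a b).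
  exact: normalized_entry.
(* The rounding model applies to computed coefficients only once they are known to be normalized.
   Each is built from coefficients of smaller order, whence strong induction on [i]. *)
have nchat i j : (0 < j <= i)%N -> (i <= n)%N -> (j <= k)%N -> normalized A (chat i j).
  elim/ltn_ind: i j => i IHi j ji i_n j_k.
  have nS S : (2 < j)%N -> sum_expr (inner_terms H chat i j) S ->
      exception_free A S -> normalized A (fl A S).
    move=> j2 sumS exS.
    have [] // := fl_sum u_lt1 sumS _ exS.
    by apply: normalized_inner_terms => // [|l m *]; [lia|apply: IHi; lia].
  have [j1|j2|j3] : [\/ j = 1%N, j = 2%N | (2 < j)%N].
    by case: j ji {j_k nS} => [|[|[|j]]] // _; [constructor 1|constructor 2|constructor 3].
  - subst j; have [->|i2] := eqVneq i 1%N.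
      by rewrite chat11; apply/normalizedN/nE; lia.
    have [|+ ->] := chat_i1 i; first lia.
    by apply: normalized_fl_bin => //= _; [apply: IHi; lia|apply: nE; lia].
  - subst j; have [->|i2] := eqVneq i 2%N.
      case: chat22 => + ->.
      by apply: normalized_fl_bin => //; apply: normalized_fl_bin => //= _; apply: nE; lia.
    have [|+ ->] := chat_i2 i; first lia.
    apply: normalized_fl_bin => //; last first.
      by apply: normalized_fl_bin => //= _; apply: nE; lia.
    apply: normalized_fl_bin => //; first by move=> _ /=; apply: IHi; lia.
    by apply: normalized_fl_bin => //= _; [apply: nE; lia|apply: IHi; lia].
  - have [ij|i2] := eqVneq i j.
      subst j; have [|S sumS [+ ->]] := chat_ii i; first lia.
      move=> exS; apply: normalizedN; move: exS.
      apply: normalized_fl_bin => //; last exact: nS.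
      apply: normalized_fl_bin => //= _; first by apply: nE; lia.
      by apply: IHi; lia.
    have [||S sumS [+ ->]] := chat_ij j i; [lia|lia|].
    apply: normalized_fl_bin => //; last exact: nS.
    apply: normalized_fl_bin => //; first by move=> _ /=; apply: IHi; lia.
    apply: normalized_fl_bin => //= _; first by apply: nE; lia.
    by apply: IHi; lia.
have nI i j : (3 <= j <= i)%N -> (i <= n)%N -> (j <= k)%N ->
    forall s, s \in inner_terms H chat i j -> {in s, forall x, normalized A x}.
  move=> ji i_n j_k; apply: normalized_inner_terms => // [|l m *]; first lia.
  by apply: nchat; lia.
have ju1 j : (j <= k)%N -> (j + 1)%:R * u < 1 by move=> jk; apply: gamma_def; lia.
split=> [i hi|j i hj hi].
  have [S sumS [[[_ _ exX] exS exXS] cE]] := chat_ii i hi.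
  have [|||nS bS] := fl_inner_terms u_lt1 _ _ _ sumS exS; [lia|apply: ju1; lia|apply: nI; lia|].
  have na : normalized A (alpha H i) by apply: nE; lia.
  have nc : normalized A (chat (i - 1)%N (i - 1)%N) by apply: nchat; lia.
  have [d du dE] := @fl_op_mul _ A FMul _ _ na nc (fun E => ltac:(discriminate E)) exX.
  have nX := @normalized_fl_op _ A FMul _ _ na nc (fun E => ltac:(discriminate E)) exX.
  have [eps epsu epsE] := @fl_opN_div _ A u_lt1 FAdd _ _ nX nS
    (fun E => ltac:(discriminate E)) exXS.
  (* For j = i the row index [i - j + 1] of the last term becomes 1. *)
  rewrite subnn add0n in bS.
  have := le_trans (inner_sum_cperr H chat i i (fl A S) _) (lerD (lexx _) bS).
  set C := _ + entry H 1 i * _ => bE.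
  (* With [C] the inner sum in exact coefficients, this identity separates the propagated error, the
     inner-sum error, the rounding [d] of the product and the rounding [eps] of the outer
     addition. *)
  have errE : cperr H chat i i = - (alpha H i * cperr H chat (i - 1) (i - 1)
      + (fl A S - C)
      + (alpha H i * chat (i - 1)%N (i - 1)%N * d + chat i i * eps)).
    have FE : fl A S = - (chat i i * (1 + eps))
        - alpha H i * chat (i - 1)%N (i - 1)%N * (1 + d).
      by rewrite cE /= mulNr epsE /= dE /=; ring.
    by rewrite {1}/cperr cpcoef_diag ?FE -/C /cperr; [ring | |lia].
  have dX : `|alpha H i * chat (i - 1)%N (i - 1)%N * d| <=
      u * `|alpha H i * chat (i - 1)%N (i - 1)%N|.
    by rewrite normrM mulrC ler_wpM2r.
  have epsc : `|chat i i * eps| <= u * `|chat i i| by rewrite normrM mulrC ler_wpM2r.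
  rewrite {1}errE normrN; apply: (le_trans (ler_normD _ _)).
  apply: (le_trans (lerD (ler_normD _ _) (ler_normD _ _))).
  move: bE dX epsc; lra.
have [S sumS [[[_ [_ _ exX] exD] exS exDS] cE]] := chat_ij j i hj hi.
have [|||nS bS] := fl_inner_terms u_lt1 _ _ _ sumS exS; [lia|apply: ju1; lia|apply: nI; lia|].
have na : normalized A (alpha H i) by apply: nE; lia.
have nc : normalized A (chat (i - 1)%N (j - 1)%N) by apply: nchat; lia.
have nc1 : normalized A (chat (i - 1)%N j) by apply: nchat; lia.
have [d du dE] := @fl_op_mul _ A FMul _ _ na nc (fun E => ltac:(discriminate E)) exX.
have nX := @normalized_fl_op _ A FMul _ _ na nc (fun E => ltac:(discriminate E)) exX.
have [d' du' dE'] := @fl_op_mul _ A FSub _ _ nc1 nX (fun E => ltac:(discriminate E)) exD.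
have nD := @normalized_fl_op _ A FSub _ _ nc1 nX (fun E => ltac:(discriminate E)) exD.
have [eps epsu epsE] := @fl_opN_div _ A u_lt1 FSub _ _ nD nS
  (fun E => ltac:(discriminate E)) exDS.
have := le_trans (inner_sum_cperr H chat i j (fl A S) _) (lerD (lexx _) bS).
set C := _ + entry H (i - j + 1) i * _ => bE.
(* Here [d'] comes from the first subtraction and [eps] from the outer one. The coefficient of order
   i - 1 meets only [d'], while the product with [alpha] meets both [d] and [d'], hence gamma_2. *)
have errE : cperr H chat i j = cperr H chat (i - 1) j
    - alpha H i * cperr H chat (i - 1) (j - 1) - (fl A S - C)
    + (chat (i - 1)%N j * d' - chat i j * eps
       - alpha H i * chat (i - 1)%N (j - 1)%N * ((1 + d) * (1 + d') - 1)).
  have FE : fl A S = (chat (i - 1)%N j - alpha H i * chat (i - 1)%N (j - 1)%N * (1 + d))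
      * (1 + d') - chat i j * (1 + eps).
    by rewrite cE /= epsE /= dE' /= dE /=; ring.
  by rewrite {1}/cperr cpcoef_offdiag ?FE -/C /cperr; [ring | |lia].
have dX : `|alpha H i * chat (i - 1)%N (j - 1)%N * ((1 + d) * (1 + d') - 1)| <=
    gamma u 2 * `|alpha H i * chat (i - 1)%N (j - 1)%N|.
  rewrite normrM mulrC ler_wpM2r //; apply: roundoff_factor_gamma => //.
    by apply: gamma_def; lia.
  by apply: (@roundoff_factorM _ _ u_lt1 1 1); exact: roundoff_factorD.
have epsc : `|chat i j * eps| <= u * `|chat i j| by rewrite normrM mulrC ler_wpM2r.
have dc : `|chat (i - 1)%N j * d'| <= u * `|chat (i - 1)%N j|.
  by rewrite normrM mulrC ler_wpM2r.
rewrite {1}errE; apply: (le_trans (ler_normD _ _)).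
apply: (le_trans (lerD (ler_normB _ _) (ler_normB _ _))).
apply: (le_trans (lerD (lerD (ler_normB _ _) (lexx _)) (lerD (ler_normB _ _) (lexx _)))).
move: bE dX epsc dc; lra.
Qed.
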